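(* For a positive integer $k$, let $m_k$ denote the minimum order of a connected graph $G$ with $c(G)\geq k$. Then: (1) $m_k = O(k^2)$ as $k\to\infty$. (2) The following two statements are equivalent: (i) (Meyniel's conjecture) there is a constant $d>0$ such that every connected graph $G$ of order $n$ satisfies $c(G)\leq d\sqrt{n}$; (ii) $m_k=\Omega(k^2)$ as $k\to\infty$.
   Context: Cops and Robbers is played on a finite, connected, undirected graph $G$. Cops first each choose a starting vertex, then the robber does; thereafter players alternate rounds, cops first, each player moving to an adjacent vertex or staying put (several cops may share a vertex). The cops win if some cop eventually occupies the robber's vertex. The cop number $c(G)$ is the minimum number of cops that have a winning strategy. *)

(* Defs.v *)
From HB Require Import structures.
From mathcomp Require Import all_boot all_order all_algebra.
From mathcomp Require Import boolp classical_sets reals topology normedtype landau.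

Set Implicit Arguments.
Unset Strict Implicit.
Unset Printing Implicit Defensive.

Import Order.TTheory GRing.Theory Num.Theory.
Import numFieldNormedType.Exports.

Record graph := Graph {
  vertex :> finType;
  adj : rel vertex;
  adj_sym : symmetric adj;
  adj_irr : irreflexive adj
}.

Definition graph_order (G : graph) : nat := #|vertex G|.

Definition connected_graph (G : graph) : Prop :=
  0 < graph_order G /\ forall x y : G, connect (@adj G) x y.

Definition legal_move (G : graph) (x y : G) : Prop := x = y \/ adj x y.

(* A strategy of [k] cops maps the list of the robber's positions so far, in
   chronological order, to the current positions of the cops: [s [::]] is the
   initial placement, chosen before the robber's, and [s [:: r_0; ...; r_t]] is
   the position of the cops after their answer to the robber being at [r_t]. *)
Definition cop_strategy (G : graph) (k : nat) := seq G -> 'I_k -> G.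

Definition legal_strategy (G : graph) (k : nat) (s : cop_strategy G k) : Prop :=
  forall (h : seq G) (x : G) (i : 'I_k), legal_move (s h i) (s (rcons h x) i).

Definition robber_play (G : graph) (r : nat -> G) : Prop :=
  forall t, legal_move (r t) (r t.+1).

(* The two cases are a meeting right after the robber's arrival at [r t], and
   right after the answer of the cops. *)
Definition captures (G : graph) (k : nat) (s : cop_strategy G k)
    (r : nat -> G) : Prop :=
  exists (t : nat) (i : 'I_k),
    s (mkseq r t) i = r t \/ s (mkseq r t.+1) i = r t.

Definition cops_win (G : graph) (k : nat) : Prop :=
  exists s : cop_strategy G k,
    legal_strategy s /\ forall r, robber_play r -> captures s r.

Lemma cops_win_order (G : graph) : cops_win G (graph_order G).
Proof.
exists (fun _ => @enum_val G (mem predT)); split=> [h x i|r _]; first by left.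
by exists 0, (enum_rank (r 0)); left; rewrite enum_rankK.
Qed.

Lemma ex_cops_win (G : graph) : exists k, `[< cops_win G k >].
Proof. by exists (graph_order G); apply/asboolP; apply: cops_win_order. Qed.

Definition cop_number (G : graph) : nat := ex_minn (ex_cops_win G).

Definition is_min_order (k n : nat) : Prop :=
  (exists G : graph, [/\ connected_graph G, k <= cop_number G & graph_order G = n]) /\
  (forall G : graph, connected_graph G -> k <= cop_number G -> n <= graph_order G).

(* Meaningful only together with [is_min_order k (min_order k)]: the default
   value is [0] if no connected graph has cop number at least [k]. *)
Definition min_order (k : nat) : nat := xget 0 [set n | is_min_order k n]%classic.

Local Open Scope ring_scope.

Definition meyniel_conjecture (R : realType) : Prop :=
  exists2 d : R, 0 < d &
    forall G : graph, connected_graph G ->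
      (cop_number G)%:R <= d * Num.sqrt (graph_order G)%:R.

(* Main.v *)
Require Import Defs.
From mathcomp Require Import all_boot all_order all_algebra.
From mathcomp Require Import finfield ring.
From mathcomp Require Import boolp classical_sets reals topology normedtype landau.

(** A robber who always moves out of the reach of the cops is never caught.  In
    a graph without cycles of length 3 or 4, the closed neighbourhood of a vertex
    other than [u] contains at most one neighbour of [u], so fewer cops than the
    minimum degree can never guard all the neighbours of [u]: the cop number is
    at least the minimum degree.  The incidence graph of the points and the
    non-vertical lines of the affine plane over the field with [q] elements is
    connected, [q]-regular, without such cycles, and has [2 q^2] vertices; taking
    for [q] the power of two with [k < q <= 2 k] gives [m_k <= 8 k^2].  Meyniel's
    bound [c(G) <= d sqrt n] for all graphs amounts to [k^2 <= d^2 m_k] for all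
    [k], and such a bound for large [k] extends to all [k] at the cost of the
    constant. *)

Import Order.TTheory GRing.Theory Num.Theory.
Import numFieldNormedType.Exports.

Lemma card_setI_bigcup {T I : finType} (A : {set T}) (B : I -> {set T}) :
  #|A :&: \bigcup_i B i| <= \sum_i #|A :&: B i|.
Proof.
rewrite big_distrr /=; elim/big_rec2: _ => [|i n C _ leCn].
  by rewrite cards0.
by apply: leq_trans (leq_card_setU _ _) _; rewrite leq_add2l.
Qed.

Section Neighbourhoods.
Context {G : graph}.

Definition neighbours (u : G) : {set G} := [set v | adj u v].

Definition closed_neighbourhood (u : G) : {set G} := u |: neighbours u.

Lemma closed_neighbourhoodP (u v : G) :
  reflect (legal_move u v) (v \in closed_neighbourhood u).
Proof.
rewrite !inE eq_sym.
by apply: (iffP orP) => -[/eqP|] ?; [left|right|left|right].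
Qed.

Definition guarded {k : nat} (cops : 'I_k -> G) : {set G} :=
  \bigcup_i closed_neighbourhood (cops i).

Lemma notin_guarded {k : nat} (cops : 'I_k -> G) (v : G) :
  v \notin guarded cops -> forall i, ~ legal_move (cops i) v.
Proof.
by move=> safe i /closed_neighbourhoodP reach; case/bigcupP: safe; exists i.
Qed.

End Neighbourhoods.

Section Evasion.
Context {G : graph} {k : nat}.
Hypothesis lt_k_order : k < graph_order G.
Hypothesis escapable : forall (cops : 'I_k -> G) (u : G),
  u \notin codom cops -> ~~ (closed_neighbourhood u \subset guarded cops).

Definition escape (cops : 'I_k -> G) (u : G) : G :=
  odflt u [pick v in closed_neighbourhood u :\: guarded cops].

Lemma escapeP {cops : 'I_k -> G} {u : G} : u \notin codom cops ->
  legal_move u (escape cops u) /\ escape cops u \notin guarded cops.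
Proof.
move=> /escapable/subsetPn[v uv safe]; rewrite /escape.
case: pickP => [w /finset.setDP[/closed_neighbourhoodP]//|/(_ v)].
by rewrite !inE safe => /negP[]; rewrite !inE in uv.
Qed.

Lemma robber_evades : ~ cops_win G k.
Proof.
move=> [s [legal_s win]].
have [u0 u0_free] : exists u0, u0 \notin codom (s [::]).
  apply/existsP; rewrite -negb_forall; apply: contraL lt_k_order.
  move=> /forallP all_occupied; rewrite -leqNgt -[k]card_ord.
  apply: leq_trans (leq_image_card (s [::]) predT).
  by apply/subset_leq_card/fintype.subsetP => u _; apply: all_occupied.
(* The robber enters the game at [r 0], as if escaping from [u0]. *)
pose answer h := escape (s h) (last u0 h).
pose history := fix history t :=
  if t is t'.+1 then rcons (history t') (answer (history t')) else [::].
pose r t := answer (history t).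
have historyE t : history t = mkseq r t.
  by elim: t => // t IH; rewrite mkseqS -IH.
have last_history t : last u0 (history t.+1) = r t by rewrite last_rcons.
have free t : last u0 (history t) \notin codom (s (history t)).
  elim: t => // t /escapeP[_ /notin_guarded safe]; rewrite last_history.
  apply/codomP => -[i caught]; apply: (safe i).
  by have := legal_s (history t) (r t) i; rewrite -[s (rcons _ _) i]caught.
have [|t [i [caught|caught]]] := win r.
- by move=> t; rewrite -[r t]last_history; have [] := escapeP (free t.+1).
- have [_ /notin_guarded/(_ i)] := escapeP (free t).
  by apply; left; rewrite historyE caught -historyE.
- by have := free t.+1; rewrite last_history historyE -caught codom_f.
Qed.

End Evasion.

Lemma cops_win_cop_number (G : graph) : cops_win G (cop_number G).
Proof. by rewrite /cop_number; case: ex_minnP => k /asboolP. Qed.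

Lemma min_degree_le_mul_cop_number {G : graph} (t d : nat) :
    0 < t -> 0 < graph_order G -> (forall u : G, d <= #|neighbours u|) ->
    (forall u v : G, u != v ->
      #|neighbours u :&: closed_neighbourhood v| <= t) ->
  d <= t * cop_number G.
Proof.
move=> t_gt0 /card_gt0P[x _] min_degree overlap.
have := cops_win_cop_number G; set k := cop_number G; rewrite leqNgt.
apply: contraPN => lt_tk_d; have lt_tk u := leq_trans lt_tk_d (min_degree u).
apply: robber_evades => [|cops u u_free].
  apply: leq_ltn_trans (leq_pmull k t_gt0) _.
  exact: leq_trans (lt_tk x) (max_card _).
apply/negP => /(fintype.subset_trans (finset.subsetUr [set u] _)).
move=> /finset.setIidPl all_guarded.
have := lt_tk u; rewrite ltnNge -all_guarded => /negP[].
apply: leq_trans (card_setI_bigcup _ _) _.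
rewrite mulnC -[X in _ <= X * _]card_ord -sum_nat_const leq_sum // => i _.
by apply: overlap; apply: contraNneq u_free => ->; apply: codom_f.
Qed.

Definition triangle_free (G : graph) : Prop :=
  forall x y z : G, adj x y -> adj y z -> ~~ adj x z.

Definition square_free (G : graph) : Prop :=
  forall x y u v : G, x != y ->
    adj x u -> adj x v -> adj y u -> adj y v -> u = v.

Lemma card_neighboursI_closed_neighbourhood {G : graph} (u v : G) :
    triangle_free G -> square_free G -> u != v ->
  #|neighbours u :&: closed_neighbourhood v| <= 1.
Proof.
move=> no_triangle no_square uv; apply/card_le1_eqP => x y.
rewrite !inE => /andP[ux /predU1P[xv|vx]] /andP[uy /predU1P[yv|vy]].
- by rewrite xv yv.
- by move: uy; rewrite (negPf (no_triangle u v y _ vy)) // -xv.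
- by move: ux; rewrite (negPf (no_triangle u v x _ vx)) // -yv.
- exact: (no_square u v).
Qed.

Lemma min_degree_le_cop_number {G : graph} (d : nat) :
    0 < graph_order G -> triangle_free G -> square_free G ->
    (forall u : G, d <= #|neighbours u|) ->
  d <= cop_number G.
Proof.
move=> G_gt0 no_triangle no_square min_degree; rewrite -[cop_number G]mul1n.
apply: min_degree_le_mul_cop_number => // u v.
exact: card_neighboursI_closed_neighbourhood.
Qed.

Local Open Scope ring_scope.

Section AffineIncidenceGraph.
Variable F : finFieldType.

(* [(false, (x, y))] is a point and [(true, (m, b))] the line of equation
   [y = m x - b]; this sign makes incidence symmetric in points and lines. *)
Definition incidence (u v : bool * (F * F)) : bool :=
  (v.1 == ~~ u.1) && (u.2.2 + v.2.2 == u.2.1 * v.2.1).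

Lemma incidence_sym : symmetric incidence.
Proof.
by move=> u v; rewrite /incidence addrC mulrC; case: u.1 v.1 => [] [].
Qed.

Lemma incidence_irr : irreflexive incidence.
Proof. by move=> u; rewrite /incidence; case: u.1. Qed.

Definition affine_incidence_graph : graph := Graph incidence_sym incidence_irr.

Lemma affine_incidence_order :
  graph_order affine_incidence_graph = (2 * #|F| ^ 2)%N.
Proof. by rewrite /graph_order /= !card_prod card_bool. Qed.

Lemma affine_incidence_triangle_free : triangle_free affine_incidence_graph.
Proof.
move=> u v w /andP[/eqP uv _] /andP[/eqP vw _].
by apply/negP => /andP[/eqP]; rewrite vw uv; case: u.1.
Qed.

Lemma affine_incidence_square_free : square_free affine_incidence_graph.
Proof.
move=> [s [a b]] [s' [a' b']] [t [x y]] [t' [x' y']] neq.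
move=> /andP[/= /eqP -> /eqP byE] /andP[/= /eqP -> /eqP by'E].
move=> /andP[/= /eqP/negb_inj ss' /eqP b'yE] /andP[/= _ /eqP b'y'E].
have /eqP : (a - a') * (x - x') = 0.
  have -> : (a - a') * (x - x') = a * x - a * x' - (a' * x - a' * x') by ring.
  by rewrite -byE -by'E -b'yE -b'y'E; ring.
rewrite mulf_eq0 !subr_eq0 => /orP[/eqP aa'|/eqP xx'].
  case/eqP: neq; rewrite ss' aa' (addIr y (_ : b + y = b' + y)) //.
  by rewrite byE b'yE aa'.
by rewrite xx' (addrI b (_ : b + y = b + y')) // byE by'E xx'.
Qed.

Lemma affine_incidence_degree (u : affine_incidence_graph) :
  #|neighbours u| = #|F|.
Proof.
case: u => s [a b].
pose nb x : affine_incidence_graph := (~~ s, (x, a * x - b)).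
have <- : #|codom nb| = #|F| by apply: card_codom => x y [].
apply: eq_card => -[t [x y]]; rewrite inE.
apply/andP/codomP => [[/= /eqP -> /eqP byE]|[z [-> -> ->]] /=].
  by exists x; rewrite /nb -byE addrC addKr.
by rewrite addrC subrK !eqxx.
Qed.

Lemma affine_incidence_connected : connected_graph affine_incidence_graph.
Proof.
split.
  rewrite affine_incidence_order muln_gt0 expn_gt0.
  by rewrite (ltnW (card_finNzRing_gt1 F)).
pose linked := connect (@adj affine_incidence_graph).
pose vert s a b : affine_incidence_graph := (s, (a, b)).
pose origin s := vert s 0 0.
have edge s a b x y : b + y = a * x -> linked (vert s a b) (vert (~~ s) x y).
  by move=> byE; apply: connect1; rewrite /= /incidence /= byE !eqxx.
have origins s t : linked (origin s) (origin t).
  have [->|t_neq_s] := eqVneq t s; first exact: connect0.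
  have -> : t = ~~ s by case: s t t_neq_s => [] [].
  by apply: edge; rewrite addr0 mul0r.
have nonzero s a b t : a != 0 -> linked (vert s a b) (origin t).
  move=> a_neq0; apply: (connect_trans (edge s a b (b / a) 0 _)).
    by rewrite addr0 mulrC divfK.
  apply: connect_trans (origins (~~ ~~ s) t).
  by apply: edge; rewrite addr0 mulr0.
have to_origin u t : linked u (origin t).
  case: u => s [a b]; have [->|] := eqVneq a 0; last exact: nonzero.
  apply: connect_trans (nonzero (~~ s) 1 (- b) t (oner_neq0 _)).
  by apply: edge; rewrite subrr mul0r.
move=> u v; apply: connect_trans (to_origin u true) _.
by rewrite (sym_connect_sym (@adj_sym affine_incidence_graph)).
Qed.

End AffineIncidenceGraph.

Lemma exists_finField_card_between (k : nat) : (0 < k)%N ->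
  exists F : finFieldType, (k < #|F| <= 2 * k)%N.
Proof.
move=> k_gt0; have /andP[le_k lt_k] := @trunc_log_bounds 2 k isT k_gt0.
have [F _ cardF] := @pPrimePowerField 2 (trunc_log 2 k).+1 isT isT.
by exists F; rewrite cardF lt_k expnS leq_mul2l.
Qed.

Lemma exists_connected_cop_number_ge (k : nat) : (0 < k)%N ->
  exists G : graph,
    [/\ connected_graph G, (k <= cop_number G)%N &
         (graph_order G <= 8 * k ^ 2)%N].
Proof.
move=> /exists_finField_card_between[F /andP[lt_k_F le_F_2k]].
have connF := affine_incidence_connected F.
exists (affine_incidence_graph F); split=> //.
  apply: leq_trans (ltnW lt_k_F) (min_degree_le_cop_number _ connF.1 _ _ _).
  - exact: affine_incidence_triangle_free.
  - exact: affine_incidence_square_free.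
  - by move=> u; rewrite affine_incidence_degree.
rewrite affine_incidence_order -[8%N]/(2 * 2 ^ 2)%N -mulnA -expnMn.
by rewrite leq_mul2l leq_exp2r.
Qed.

Local Open Scope classical_set_scope.

Lemma is_min_order_min_order (k : nat) : is_min_order k (min_order k).
Proof.
apply: (@xgetPex _ 0%N [set n | is_min_order k n]).
pose realized n :=
  `[< exists G : graph,
        [/\ connected_graph G, (k <= cop_number G)%N & graph_order G = n] >].
have /ex_minnP[n /asboolP n_realized n_min] : exists n, realized n.
  have [G [connG kG _]] := @exists_connected_cop_number_ge k.+1 isT.
  by exists (graph_order G); apply/asboolP; exists G; rewrite (ltnW kG).
exists n; split => // G connG kG.
by apply: n_min; apply/asboolP; exists G.
Qed.

Lemma min_order_gt0 (k : nat) : (0 < min_order k)%N.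
Proof. by have [[G [[G_gt0 _] _ <-]] _] := is_min_order_min_order k. Qed.

Lemma min_order_le (k : nat) : (0 < k)%N -> (min_order k <= 8 * k ^ 2)%N.
Proof.
move=> /exists_connected_cop_number_ge[G [connG kG]]; apply: leq_trans.
exact: (is_min_order_min_order k).2.
Qed.

Lemma min_order_cop_number_le (G : graph) :
  connected_graph G -> (min_order (cop_number G) <= graph_order G)%N.
Proof. by move=> connG; apply: (is_min_order_min_order _).2. Qed.

Lemma eqO_natP {K : numFieldType} {V W : normedModType K}
    (f : nat -> V) (g : nat -> W) : (forall n, g n = 0 -> f n = 0) ->
  f =O_\oo g <-> exists2 C : K, 0 < C & forall n, `|f n| <= C * `|g n|.
Proof.
move=> fg0; split=> [/eqO_exP[C C_gt0 [N _ large]]|[C C_gt0 fCg]]; last first.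
  by apply/eqO_exP; exists C => //; apply: nearW.
pose S := \sum_(i < N) `|f i| / `|g i|.
have S_ge0 : 0 <= S by apply: sumr_ge0 => i _; rewrite divr_ge0.
exists (C + S); first by rewrite ltr_wpDr.
move=> n; have [/large fCg|n_lt_N] := leqP N n.
  by apply: le_trans fCg _; rewrite ler_wpM2r // lerDl.
have [gn0|gn_neq0] := eqVneq (g n) 0.
  by rewrite (fg0 _ gn0) gn0 !normr0 mulr0.
rewrite -ler_pdivrMr ?normr_gt0 //; apply: ler_wpDl; first exact: ltW.
rewrite /S (bigD1 (Ordinal n_lt_N)) //= lerDl.
by apply: sumr_ge0 => i _; rewrite divr_ge0.
Qed.

Lemma meyniel_conjectureP (R : realType) : meyniel_conjecture R <->
  exists2 C : R, 0 < C & forall k, k%:R ^+ 2 <= C * (min_order k)%:R.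
Proof.
split=> [[d d_gt0 meyniel]|[C C_gt0 quadratic]].
  exists (d ^+ 2); first exact: exprn_gt0.
  move=> k; have [[G [connG kG <-]] _] := is_min_order_min_order k.
  rewrite -[X in _ * X]sqr_sqrtr ?ler0n // -exprMn lerXn2r ?nnegrE ?ler0n //.
    by rewrite mulr_ge0 ?sqrtr_ge0 ?ltW.
  by apply: le_trans (meyniel G connG); rewrite ler_nat.
exists (Num.sqrt C); first by rewrite sqrtr_gt0.
move=> G connG; rewrite -sqrtrM ?(ltW C_gt0) //.
rewrite -[X in X <= _]normr_nat -sqrtr_sqr.
apply/ler_wsqrtr/(le_trans (quadratic _)).
by rewrite ler_pM2l // ler_nat min_order_cop_number_le.
Qed.

Lemma min_order_bigO (R : realType) :
  (fun k : nat => (min_order k)%:R : R) =O_\oo (fun k : nat => k%:R ^+ 2 : R).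
Proof.
apply/eqO_exP; exists 8 => //; near=> k.
have k_gt0 : (0 < k)%N by near: k; apply: nbhs_infty_gt.
by rewrite normrX !normr_nat -natrX -natrM ler_nat min_order_le.
Unshelve. all: by end_near. Qed.

Lemma meyniel_iff_min_order_bigOmega (R : realType) :
  meyniel_conjecture R <->
    (fun k : nat => (min_order k)%:R : R) =Omega_\oo (fun k : nat => k%:R ^+ 2 : R).
Proof.
rewrite meyniel_conjectureP eqOmegaE eqOmegaO eqO_natP => [|k /eqP].
  by split=> -[C C_gt0 bound]; exists C => // k; have := bound k;
    rewrite normrX !normr_nat.
by rewrite pnatr_eq0 -leqn0 leqNgt min_order_gt0.
Qed.

Theorem theorem3 (R : realType) :
  (forall k : nat, (0 < k)%N -> is_min_order k (min_order k)) /\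
  (fun k : nat => (min_order k)%:R : R) =O_\oo (fun k : nat => k%:R ^+ 2 : R) /\
  (meyniel_conjecture R <->
    (fun k : nat => (min_order k)%:R : R) =Omega_\oo (fun k : nat => k%:R ^+ 2 : R)).
Proof.
split; first by move=> k _; apply: is_min_order_min_order.
split; first exact: min_order_bigO.
exact: meyniel_iff_min_order_bigOmega.
Qed.
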